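(* Let $\Gamma\subseteq\{\mathsf T,\mathsf 4,\mathsf B,\mathsf 5,\mathsf{.2}\}$ and let $\Theta_\Gamma$ be the set of first-order relational properties corresponding to the members of $\Gamma$ ($\mathsf T\mapsto$ reflexivity, $\mathsf 4\mapsto$ transitivity, $\mathsf B\mapsto$ symmetry, $\mathsf 5\mapsto$ Euclideanity, $\mathsf{.2}\mapsto$ directedness). Then: (1) the class of modal L-spaces whose relation $R$ satisfies $\Theta_\Gamma$ is exactly (up to isomorphism) the class of dual modal L-spaces $\mathsf{Fil_L}(A)$ of modal lattices $A\in\mathsf K(\Gamma)$; (2) the logic $\mathcal L(\Gamma)$ is sound and complete with respect to the class $\mathsf C$ of modal L-frames whose relation satisfies $\Theta_\Gamma$, i.e. for every consequence pair $\phi\trianglelefteq\psi$, every frame in $\mathsf C$ validates $\phi\trianglelefteq\psi$ iff $\phi\trianglelefteq\psi\in\mathcal L(\Gamma)$.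
   Context: Formulas over letters $P$: $p\mid\top\mid\bot\mid\phi\wedge\psi\mid\phi\vee\psi\mid\Box\phi\mid\Diamond\phi$. Consequence pairs are expressions $\phi\trianglelefteq\psi$. The axioms are: $\mathsf T$ = $\{\Box p\trianglelefteq p,\ p\trianglelefteq\Diamond p\}$; $\mathsf 4$ = $\{\Box p\trianglelefteq\Box\Box p,\ \Diamond\Diamond p\trianglelefteq\Diamond p\}$; $\mathsf B$ = $\{p\trianglelefteq\Box\Diamond p,\ \Diamond\Box p\trianglelefteq p\}$; $\mathsf 5$ = $\{\Diamond p\trianglelefteq\Box\Diamond p,\ \Diamond\Box p\trianglelefteq\Box p\}$; $\mathsf{.2}$ = $\{\Diamond\Box p\trianglelefteq\Box\Diamond p\}$. $\mathcal L(\Gamma)$ is the smallest set of consequence pairs containing (the pairs of) $\Gamma$, closed under uniform substitution, containing the axioms $p\trianglelefteq\top$, $\bot\trianglelefteq p$, $p\trianglelefteq p$, $p\wedge q\trianglelefteq p$, $p\wedge q\trianglelefteq q$, $p\trianglelefteq p\vee q$, $q\trianglelefteq p\vee q$, $\top\trianglelefteq\Box\top$, $\top\trianglelefteq\Diamond\top$, $\Box p\wedge\Box q\trianglelefteq\Box(p\wedge q)$, $\Diamond p\wedge\Box q\trianglelefteq\Diamond(p\wedge q)$, and closed under: transitivity ($p\trianglelefteq q$, $q\trianglelefteq r$ give $p\trianglelefteq r$), right conjunction ($p\trianglelefteq q$, $p\trianglelefteq r$ give $p\trianglelefteq q\wedge r$), left disjunction ($p\trianglelefteq r$, $q\trianglelefteq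 r$ give $p\vee q\trianglelefteq r$), and monotonicity of $\Box$ and $\Diamond$. A modal lattice is a bounded lattice with $\Box,\Diamond$ satisfying $\Box\top=\top$, $\Diamond\top=\top$, $\Box a\wedge\Box b=\Box(a\wedge b)$, $\Diamond a\vee\Diamond b\le\Diamond(a\vee b)$, $\Diamond a\wedge\Box b\le\Diamond(a\wedge b)$. $A$ validates $\phi\trianglelefteq\psi$ if $\sigma(\phi)\le\sigma(\psi)$ for all valuations (homomorphisms from formulas) $\sigma$ into $A$; $\mathsf K(\Gamma)$ is the variety of modal lattices validating all pairs in $\Gamma$. A filter of a meet semilattice $(X,1,\curlywedge)$ (order $\preceq$) is a nonempty upset closed under $\curlywedge$. A modal L-frame is $(X,1,\curlywedge,R)$ with $R$ a binary relation such that: (a) $x\preceq y$, $y\mathrel Rz$ imply some $w$ with $x\mathrel Rw\preceq z$; (b) $x\preceq y$, $x\mathrel Rw$ imply some $z$ with $y\mathrel Rz$, $w\preceq z$; (c) $(x\curlywedge y)\mathrel Rz$ implies some $u,v$ with $x\mathrel Ru$, $y\mathrel Rv$, $u\curlywedge v\preceq z$; (d) $x\mathrel Ru$, $y\mathrel Rv$ imply $(x\curlywedge y)\mathrel R(u\curlywedge v)$; (e) $1\mathrel Rx$ iff $x=1$. A valuation $V$ assigns a filter to each letter; truth: $\top$ always; $\bot$ at $x$ iff $x=1$; $p$ at $x$ iff $x\in V(p)$; $\phi\wedge\psi$ componentwise; $\phi\vee\psi$ at $x$ iff there are $y\Vdash\phi$, $z\Vdash\psi$ with $y\curlywedge z\preceq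 x$; $\Box\phi$ at $x$ iff all $R$-successors satisfy $\phi$; $\Diamond\phi$ at $x$ iff some $R$-successor satisfies $\phi$. A frame validates $\phi\trianglelefteq\psi$ if for all valuations the truth set of $\phi$ is contained in that of $\psi$. An L-space is a meet semilattice with top $(X,1,\curlywedge)$ with compact topology such that $x\not\preceq y$ implies a clopen filter containing $x$ but not $y$, $\{1\}$ is clopen, and the filter generated by the union of two clopen filters is clopen. With $\Box_RU=\{x\mid R[x]\subseteq U\}$, $\Diamond_RU=\{x\mid R[x]\cap U\ne\emptyset\}$, a modal L-space is an L-space with $R$ such that $1\mathrel Rx$ iff $x=1$; $\Box_RU,\Diamond_RU$ are clopen filters for clopen filters $U$; and $x\mathrel Ry$ iff for every clopen filter $U$, $x\in\Box_RU\Rightarrow y\in U$ and $y\in U\Rightarrow x\in\Diamond_RU$. For a modal lattice $A$, $\mathsf{Fil_L}(A)$ is the set of lattice filters of $A$ ordered by inclusion (meet = intersection, top = $A$), topologized by taking the sets $\{F\mid a\in F\}$ ($a\in A$) and their complements as subbasic clopens, with $F\mathrel RG$ iff for all $a$, $\Box a\in F\Rightarrow a\in G$ and $a\in G\Rightarrow\Diamond a\in F$. The properties: reflexivity $\forall x\,xRx$; transitivity; symmetry; Euclideanity $xRy\wedge xRz\to yRz$; directedness $xRy\wedge xRz\to\exists t(yRt\wedge zRt)$.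
   Formalization: Modal L-spaces are additionally required to be serial (every point has an R-successor, i.e. ◇_R X = X); without this, part (1) fails, e.g. for the discrete chain {0<1} with R = {(1,1)}, as every Fil_L(A) is serial. *)

(* Defs.v *)
From HB Require Import structures.
From mathcomp Require Import all_boot all_order.
From mathcomp Require Import boolp classical_sets topology.

Set Implicit Arguments.
Unset Strict Implicit.
Unset Printing Implicit Defensive.

Import Order.TTheory.
Local Open Scope classical_set_scope.

(** * Formulas, consequence pairs and logics *)

Inductive formula (P : Type) : Type :=
| Var of P
| Top
| Bot
| And of formula P & formula P
| Or of formula P & formula P
| Box of formula P
| Dia of formula P.
Arguments Top {P}.
Arguments Bot {P}.

Fixpoint subst (P : Type) (s : P -> formula P) (phi : formula P) : formula P :=
  match phi with
  | Var p => s p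
  | Top => Top
  | Bot => Bot
  | And phi1 phi2 => And (subst s phi1) (subst s phi2)
  | Or phi1 phi2 => Or (subst s phi1) (subst s phi2)
  | Box phi1 => Box (subst s phi1)
  | Dia phi1 => Dia (subst s phi1)
  end.

(* [(phi, psi)] is the consequence pair written phi ⊴ psi. *)
Definition cpair (P : Type) : Type := (formula P * formula P)%type.

Inductive axname : Type := axT | ax4 | axB | ax5 | axdot2.

(* [p] is the letter in which the axioms are written. *)
Definition ax_pairs (P : Type) (p : P) (a : axname) : set (cpair P) :=
  let v := Var p in
  match a with
  | axT => [set (Box v, v); (v, Dia v)]
  | ax4 => [set (Box v, Box (Box v)); (Dia (Dia v), Dia v)]
  | axB => [set (v, Box (Dia v)); (Dia (Box v), v)]
  | ax5 => [set (Dia v, Box (Dia v)); (Dia (Box v), Box v)]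
  | axdot2 => [set (Dia (Box v), Box (Dia v))]
  end.

Definition pairs_of (P : Type) (p : P) (Gamma : set axname) : set (cpair P) :=
  \bigcup_(a in Gamma) ax_pairs p a.

(* The axioms are stated for two fixed letters [p] and [q] (which should be
   distinct) and reach arbitrary formulas through [L_subst]; the rules are
   schematic in formulas. *)
Inductive logic (P : Type) (p q : P) (G : set (cpair P)) : cpair P -> Prop :=
| L_hyp c : G c -> logic p q G c
| L_subst (s : P -> formula P) phi psi :
    logic p q G (phi, psi) -> logic p q G (subst s phi, subst s psi)
| L_top : logic p q G (Var p, Top)
| L_bot : logic p q G (Bot, Var p)
| L_refl : logic p q G (Var p, Var p)
| L_andl : logic p q G (And (Var p) (Var q), Var p)
| L_andr : logic p q G (And (Var p) (Var q), Var q)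
| L_orl : logic p q G (Var p, Or (Var p) (Var q))
| L_orr : logic p q G (Var q, Or (Var p) (Var q))
| L_box_top : logic p q G (Top, Box Top)
| L_dia_top : logic p q G (Top, Dia Top)
| L_box_and :
    logic p q G (And (Box (Var p)) (Box (Var q)), Box (And (Var p) (Var q)))
| L_dia_and :
    logic p q G (And (Dia (Var p)) (Box (Var q)), Dia (And (Var p) (Var q)))
| L_trans phi psi chi :
    logic p q G (phi, psi) -> logic p q G (psi, chi) -> logic p q G (phi, chi)
| L_and phi psi chi :
    logic p q G (phi, psi) -> logic p q G (phi, chi) ->
    logic p q G (phi, And psi chi)
| L_or phi psi chi :
    logic p q G (phi, chi) -> logic p q G (psi, chi) ->
    logic p q G (Or phi psi, chi)
| L_box phi psi : logic p q G (phi, psi) -> logic p q G (Box phi, Box psi)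
| L_dia phi psi : logic p q G (phi, psi) -> logic p q G (Dia phi, Dia psi).

(** * Modal lattices *)

Record modal_lattice (d : Order.disp_t) (A : tbLatticeType d)
    (box dia : A -> A) : Prop := ModalLattice {
  ml_box_top : box \top%O = \top%O;
  ml_dia_top : dia \top%O = \top%O;
  ml_box_meet : forall a b, (box a `&` box b)%O = box (a `&` b)%O;
  ml_dia_join : forall a b, (dia a `|` dia b <= dia (a `|` b))%O;
  ml_dia_box : forall a b, (dia a `&` box b <= dia (a `&` b))%O
}.

Fixpoint eval (P : Type) (d : Order.disp_t) (A : tbLatticeType d)
    (box dia : A -> A) (s : P -> A) (phi : formula P) : A :=
  match phi with
  | Var p => s p
  | Top => \top%O
  | Bot => \bot%O
  | And phi1 phi2 => (eval box dia s phi1 `&` eval box dia s phi2)%O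
  | Or phi1 phi2 => (eval box dia s phi1 `|` eval box dia s phi2)%O
  | Box phi1 => box (eval box dia s phi1)
  | Dia phi1 => dia (eval box dia s phi1)
  end.

Definition lattice_validates (P : Type) (d : Order.disp_t)
    (A : tbLatticeType d) (box dia : A -> A) (c : cpair P) : Prop :=
  forall s : P -> A, (eval box dia s c.1 <= eval box dia s c.2)%O.

Definition in_variety (P : Type) (G : set (cpair P)) (d : Order.disp_t)
    (A : tbLatticeType d) (box dia : A -> A) : Prop :=
  modal_lattice box dia /\ forall c, G c -> lattice_validates box dia c.

(** * Filters and modal L-frames *)

Definition mfilter (d : Order.disp_t) (X : tMeetSemilatticeType d)
    (F : set X) : Prop :=
  [/\ F !=set0,
      forall x y : X, (x <= y)%O -> F x -> F y
    & forall x y : X, F x -> F y -> F (x `&` y)%O].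

Record modal_Lframe (d : Order.disp_t) (X : tMeetSemilatticeType d)
    (R : X -> X -> Prop) : Prop := ModalLframe {
  mf_back : forall x y z : X, (x <= y)%O -> R y z ->
    exists w, R x w /\ (w <= z)%O;
  mf_forth : forall x y w : X, (x <= y)%O -> R x w ->
    exists z, R y z /\ (w <= z)%O;
  mf_meet_split : forall x y z : X, R (x `&` y)%O z ->
    exists u v, [/\ R x u, R y v & (u `&` v <= z)%O];
  mf_meet : forall x y u v : X, R x u -> R y v -> R (x `&` y)%O (u `&` v)%O;
  mf_top : forall x : X, R \top%O x <-> x = \top%O
}.

Fixpoint truth (P : Type) (d : Order.disp_t) (X : tMeetSemilatticeType d)
    (R : X -> X -> Prop) (V : P -> set X) (phi : formula P) : set X :=
  match phi with
  | Var p => V p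
  | Top => setT
  | Bot => [set \top%O]
  | And phi1 phi2 => truth R V phi1 `&` truth R V phi2
  | Or phi1 phi2 => [set x | exists y z,
      [/\ truth R V phi1 y, truth R V phi2 z & (y `&` z <= x)%O]]
  | Box phi1 => [set x | forall y, R x y -> truth R V phi1 y]
  | Dia phi1 => [set x | exists y, R x y /\ truth R V phi1 y]
  end.

Definition frame_validates (P : Type) (d : Order.disp_t)
    (X : tMeetSemilatticeType d) (R : X -> X -> Prop) (c : cpair P) : Prop :=
  forall V : P -> set X, (forall p, mfilter (V p)) ->
    truth R V c.1 `<=` truth R V c.2.

(** * Relational properties *)

Definition rel_prop (X : Type) (R : X -> X -> Prop) (a : axname) : Prop :=
  match a with
  | axT => forall x, R x x
  | ax4 => forall x y z, R x y -> R y z -> R x z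
  | axB => forall x y, R x y -> R y x
  | ax5 => forall x y z, R x y -> R x z -> R y z
  | axdot2 => forall x y z, R x y -> R x z -> exists t, R y t /\ R z t
  end.

Definition satisfies_Theta (Gamma : set axname) (X : Type)
    (R : X -> X -> Prop) : Prop :=
  forall a, Gamma a -> rel_prop R a.

(** * Modal L-spaces *)

(* The library already joins neighbourhoods with total orders, which makes
   Hierarchy Builder refuse a common substructure of [tMeetSemilatticeType] and
   [topologicalType]; hence a record carrying two structures on one carrier. *)
Record topMeetType (d : Order.disp_t) : Type := TopMeet {
  tm_semilattice :> tMeetSemilatticeType d;
  tm_class : Topological.axioms_ tm_semilattice
}.

Definition tm_space (d : Order.disp_t) (X : topMeetType d) : topologicalType :=
  Topological.Pack (tm_class X).

Definition clopen_in (d : Order.disp_t) (X : topMeetType d) (U : set X) : Prop :=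
  @clopen (tm_space X) U.

Definition clopen_filter (d : Order.disp_t) (X : topMeetType d)
    (U : set X) : Prop := clopen_in U /\ mfilter U.

Record Lspace (d : Order.disp_t) (X : topMeetType d) : Prop := LSpace {
  ls_compact : compact [set: tm_space X];
  ls_separated : forall x y : X, ~ (x <= y)%O ->
    exists U : set X, [/\ clopen_filter U, U x & ~ U y];
  ls_top : clopen_in [set (\top%O : X)];
  ls_join : forall U V : set X, clopen_filter U -> clopen_filter V ->
    clopen_in (smallest (@mfilter d X) (U `|` V))
}.

Definition boxR (X : Type) (R : X -> X -> Prop) (U : set X) : set X :=
  [set x | forall y, R x y -> U y].

Definition diaR (X : Type) (R : X -> X -> Prop) (U : set X) : set X :=
  [set x | exists y, R x y /\ U y].

(* [ms_dia_top] says that every point has an R-successor. It is the dual of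
   ◇⊤ = ⊤ and does not follow from the other clauses: on the two-element chain
   with the discrete topology, the relation {(1, 1)} satisfies all of them,
   while the dual of a modal lattice always satisfies [ms_dia_top]. *)
Record modal_Lspace (d : Order.disp_t) (X : topMeetType d)
    (R : X -> X -> Prop) : Prop := ModalLspace {
  ms_Lspace : Lspace X;
  ms_dia_top : diaR R [set: X] = [set: X];
  ms_top : forall x : X, R \top%O x <-> x = \top%O;
  ms_box : forall U : set X, clopen_filter U -> clopen_filter (boxR R U);
  ms_dia : forall U : set X, clopen_filter U -> clopen_filter (diaR R U);
  ms_tight : forall x y : X, R x y <->
    forall U : set X, clopen_filter U ->
      (boxR R U x -> U y) /\ (U y -> diaR R U x)
}.

Definition modal_Lspace_iso (d d' : Order.disp_t)
    (X : topMeetType d) (R : X -> X -> Prop)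
    (Y : topMeetType d') (S : Y -> Y -> Prop) : Prop :=
  exists (f : X -> Y) (g : Y -> X),
    [/\ cancel f g /\ cancel g f,
        continuous (f : tm_space X -> tm_space Y) /\
          continuous (g : tm_space Y -> tm_space X),
        f \top%O = \top%O,
        forall x y, f (x `&` y)%O = (f x `&` f y)%O
      & forall x y, R x y <-> S (f x) (f y)].

(** * The dual space of a modal lattice *)

Record FilL (d : Order.disp_t) (A : tbLatticeType d) : Type := MkFilL {
  FilL_set :> set A;
  FilL_filter : mfilter FilL_set
}.

Fact FilL_display : Order.disp_t. Proof. exact: (Order.Disp tt tt). Qed.

Section FilL.
Variables (d : Order.disp_t) (A : tbLatticeType d).
Implicit Types F G : FilL A.

Lemma FilL_inj F G : FilL_set F = FilL_set G -> F = G.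
Proof.
case: F G => [F hF] [G hG] /= E; move: hF; rewrite E => hF.
by rewrite (Prop_irrelevance hF hG).
Qed.

HB.instance Definition _ := gen_eqMixin (FilL A).
HB.instance Definition _ := gen_choiceMixin (FilL A).

Definition FilL_le F G : bool := `[< FilL_set F `<=` FilL_set G >].

Fact FilL_le_refl : reflexive FilL_le.
Proof. by move=> F; apply/asboolP. Qed.

Fact FilL_le_anti : antisymmetric FilL_le.
Proof.
move=> F G /andP[/asboolP FG /asboolP GF]; apply: FilL_inj.
by apply/seteqP; split.
Qed.

Fact FilL_le_trans : transitive FilL_le.
Proof.
move=> G F H /asboolP FG /asboolP GH; apply/asboolP.
exact: subset_trans GH.
Qed.

HB.instance Definition _ := Order.Le_isPOrder.Build FilL_display (FilL A)
  FilL_le_refl FilL_le_anti FilL_le_trans.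

Lemma mfilter_top (F : set A) : mfilter F -> F \top%O.
Proof. by case=> -[x Fx] up _; apply: up Fx; apply: lex1. Qed.

Fact FilL_meet_subproof F G : mfilter (FilL_set F `&` FilL_set G).
Proof.
case: F G => [F hF] [G hG] /=; split.
- by exists \top%O; split; apply: mfilter_top.
- case: hF hG => _ upF _ [_ upG _] x y xy [Fx Gx].
  by split; [apply: upF xy Fx | apply: upG xy Gx].
- case: hF hG => _ _ mF [_ _ mG] x y [Fx Gx] [Fy Gy].
  by split; [apply: mF | apply: mG].
Qed.

Definition FilL_meet F G : FilL A := MkFilL (FilL_meet_subproof F G).

Fact FilL_meetP F G H :
  (F <= FilL_meet G H)%O = (F <= G)%O && (F <= H)%O.
Proof.
apply/asboolP/andP => [FGH|[/asboolP FG /asboolP FH] x Fx].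
  by split; apply/asboolP => x /FGH[].
by split; [apply: FG | apply: FH].
Qed.

HB.instance Definition _ :=
  Order.POrder_isMeetSemilattice.Build FilL_display (FilL A) FilL_meetP.

Fact FilL_top_subproof : mfilter [set: A].
Proof. by split=> //; exists \top%O. Qed.

Definition FilL_top : FilL A := MkFilL FilL_top_subproof.

Fact FilL_lex1 F : (F <= FilL_top)%O.
Proof. by apply/asboolP. Qed.

HB.instance Definition _ :=
  Order.hasTop.Build FilL_display (FilL A) FilL_lex1.

Definition FilL_subbase : set (set (FilL A)) :=
  [set U | exists a : A, U = [set F | FilL_set F a] \/
                         U = ~` [set F | FilL_set F a]].

HB.instance Definition _ :=
  isSubBaseTopological.Build (FilL A) FilL_subbase id.

Definition FilL_space : topMeetType FilL_display :=
  @TopMeet FilL_display (FilL A) (Topological.class (FilL A)).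

Definition FilL_rel (box dia : A -> A) (F G : FilL_space) : Prop :=
  forall a : A,
    (FilL_set F (box a) -> FilL_set G a) /\ (FilL_set G a -> FilL_set F (dia a)).

End FilL.

(* Main.v *)
Require Import Defs.
From HB Require Import structures.
From mathcomp Require Import all_boot all_order.
From mathcomp Require Import boolp classical_sets topology.

(** Everything rests on the filters of a modal lattice. For filters [F] and [G]
    with [G] contained in the inverse image of [F] under ◇, the axiom
    ◇a ∧ □b ≤ ◇(a ∧ b) makes the filter generated by [G] and the inverse image
    of [F] under □ an R-successor of [F]. Hence membership of □a and ◇a in [F]
    is Kripke truth at [F], the filters form a modal L-frame, and each axiom
    yields its relational property on them. For completeness one takes the
    filters of the Lindenbaum algebra. For the duality, the clopen filters of
    the space of filters are exactly the sets [hat a] = {F | a ∈ F}, while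
    compactness of an L-space shows that every filter of its lattice of clopen
    filters consists of the clopen filters containing one point. *)

Set Implicit Arguments.
Unset Strict Implicit.
Unset Printing Implicit Defensive.

Import Order.TTheory.
Local Open Scope classical_set_scope.

(** * Soundness over modal L-frames *)

(** The axioms are built from a letter with □ and ◇ only, so the usual Kripke argument applies to
    arbitrary sets [V x]. It serves both frames, in the soundness proof, and spaces, where [V] takes
    clopen filters as values. *)
Lemma ax_pairs_truth (P : Type) (p : P) (a : axname) (d : Order.disp_t)
    (X : tMeetSemilatticeType d) (R : X -> X -> Prop) (V : P -> set X)
    (c : cpair P) :
  rel_prop R a -> ax_pairs p a c -> truth R V c.1 `<=` truth R V c.2.
Proof.
case: a => /= HR.
- by case=> -> x /= Vx; [apply: Vx | exists x].
- case=> -> x /=; first by move=> Vx y Rxy z Ryz; apply: Vx; apply: HR Ryz.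
  by move=> [y [Rxy [z [Ryz Vz]]]]; exists z; split=> //; apply: HR Ryz.
- case=> -> x /=; first by move=> Vx y Rxy; exists x; split=> //; apply: HR.
  by move=> [y [Rxy]]; apply; apply: HR.
- case=> -> x /= [y [Rxy Vy]] z Rxz; last by apply: Vy; apply: HR Rxz.
  by exists y; split=> //; apply: HR Rxy.
- move=> -> x /= [y [Rxy Vy]] z Rxz.
  by have [t [Ryt Rzt]] := HR _ _ _ Rxy Rxz; exists t; split=> //; apply: Vy.
Qed.

(** * Filters of a meet semilattice and their joins *)

Section MeetSemilatticeFilters.
Variables (d : Order.disp_t) (X : tMeetSemilatticeType d).
Implicit Types (F G : set X) (x y : X).

Lemma mfilter_1 F : mfilter F -> F \top%O.
Proof. by case=> -[x Fx] up _; apply: up Fx; apply: lex1. Qed.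

Lemma mfilter_up F x y : mfilter F -> (x <= y)%O -> F x -> F y.
Proof. by case=> _ up _; apply: up. Qed.

Lemma mfilter_meet F x y : mfilter F -> F x -> F y -> F (x `&` y)%O.
Proof. by case=> _ _; apply. Qed.

Lemma mfilter_meetE F x y : mfilter F -> F (x `&` y)%O <-> F x /\ F y.
Proof.
move=> fF; split=> [Fxy|[Fx Fy]]; last exact: mfilter_meet.
by split; apply: mfilter_up Fxy => //; [apply: leIl | apply: leIr].
Qed.

Lemma mfilter_setT : mfilter [set: X].
Proof. by split=> //; exists \top%O. Qed.

Lemma mfilter_set1 : mfilter [set \top%O : X].
Proof.
split=> [|x y xy /= Ex|x y /= -> ->]; first by exists \top%O.
  by apply/eqP; rewrite -le1x -Ex.
exact: meetxx.
Qed.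

Lemma mfilter_setI F G : mfilter F -> mfilter G -> mfilter (F `&` G).
Proof.
move=> fF fG; split; first by exists \top%O; split; apply: mfilter_1.
  by move=> x y xy [Fx Gx]; split; apply: mfilter_up xy _.
by move=> x y [Fx Gx] [Fy Gy]; split; apply: mfilter_meet.
Qed.

(** The join in the lattice of filters, in the form of the truth clause for ∨, so that lemmas about
    it apply to [truth R V (Or _ _)] by conversion. *)
Definition filter_join F G : set X :=
  [set x | exists y z, [/\ F y, G z & (y `&` z <= x)%O]].

Lemma filter_join_mfilter F G :
  mfilter F -> mfilter G -> mfilter (filter_join F G).
Proof.
move=> fF fG; split.
- exists \top%O, \top%O, \top%O.
  by split; [apply: mfilter_1 | apply: mfilter_1 | apply: lex1].
- move=> x y xy [u [v [Fu Gv uv]]]; exists u, v; split=> //.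
  exact: le_trans xy.
- move=> x y [u [v [Fu Gv uv]]] [u' [v' [Fu' Gv' uv']]].
  exists (u `&` u')%O, (v `&` v')%O; split; try exact: mfilter_meet.
  by rewrite meetACA leI2.
Qed.

Lemma sub_filter_joinl F G : mfilter G -> F `<=` filter_join F G.
Proof.
move=> fG x Fx; exists x, \top%O; split=> //; first exact: mfilter_1.
exact: leIl.
Qed.

Lemma sub_filter_joinr F G : mfilter F -> G `<=` filter_join F G.
Proof.
move=> fF x Gx; exists \top%O, x; split=> //; first exact: mfilter_1.
exact: leIr.
Qed.

Lemma filter_join_sub F G H : mfilter H -> F `<=` H -> G `<=` H ->
  filter_join F G `<=` H.
Proof.
move=> fH FH GH x [y [z [Fy Gz yz]]]; apply: mfilter_up yz _ => //.
by apply: mfilter_meet => //; [apply: FH | apply: GH].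
Qed.

(** Links the generated filter in [ls_join] with the explicit elementwise description. *)
Lemma smallest_mfilterU F G : mfilter F -> mfilter G ->
  smallest (@mfilter d X) (F `|` G) = filter_join F G.
Proof.
move=> fF fG; apply/seteqP; split.
  apply: smallest_sub; first exact: filter_join_mfilter.
  by move=> x []; [apply: sub_filter_joinl | apply: sub_filter_joinr].
move=> x FGx H [fH FGH]; apply: filter_join_sub FGx => //.
  by move=> y Fy; apply: FGH; left.
by move=> y Gy; apply: FGH; right.
Qed.

End MeetSemilatticeFilters.

(** * Truth sets are filters, and the rules preserve frame validity *)

Section FrameSoundness.
Variables (P : Type) (d : Order.disp_t) (X : tMeetSemilatticeType d).
Variables (R : X -> X -> Prop) (frR : modal_Lframe R).

(** Each frame condition pays for one closure property: [mf_back] and [mf_meet_split] make □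
    preserve upsets and meets, [mf_forth] and [mf_meet] do so for ◇, and [mf_top] puts the top in
    both. *)
Lemma truth_mfilter (V : P -> set X) : (forall p, mfilter (V p)) ->
  forall phi, mfilter (truth R V phi).
Proof.
move=> fV; elim=> [p|||f1 IH1 f2 IH2|f1 IH1 f2 IH2|f IH|f IH] //=.
- exact: mfilter_setT.
- exact: mfilter_set1.
- exact: mfilter_setI.
- exact: filter_join_mfilter.
- split.
  + by exists \top%O => y /(mf_top frR) ->; apply: mfilter_1.
  + move=> x y xy fx z Ryz; have [w [Rxw wz]] := mf_back frR xy Ryz.
    by apply: mfilter_up wz _ => //; apply: fx.
  + move=> x y fx fy z /(mf_meet_split frR)[u [v [Rxu Ryv uv]]].
    apply: mfilter_up uv _ => //.
    by apply: mfilter_meet => //; [apply: fx | apply: fy].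
- split.
  + exists \top%O, \top%O; split; first exact/(mf_top frR).
    exact: mfilter_1.
  + move=> x y xy [w [Rxw fw]]; have [z [Ryz wz]] := mf_forth frR xy Rxw.
    by exists z; split=> //; apply: mfilter_up wz _.
  + move=> x y [u [Rxu fu]] [v [Ryv fv]]; exists (u `&` v)%O.
    by split; [apply: mf_meet | apply: mfilter_meet].
Qed.

Lemma truth_subst (V : P -> set X) (s : P -> formula P) phi :
  truth R V (subst s phi) = truth R (fun r => truth R V (s r)) phi.
Proof.
by elim: phi => [r|||f1 IH1 f2 IH2|f1 IH1 f2 IH2|f IH|f IH] //=;
  rewrite ?IH1 ?IH2 ?IH.
Qed.

Lemma logic_frame_sound (p q : P) (Gamma : set axname) :
  satisfies_Theta Gamma R -> forall c, logic p q (pairs_of p Gamma) c ->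
  frame_validates R c.
Proof.
move=> thR c; elim=> {c}.
- by move=> c [a Ga ac] V fV; apply: ax_pairs_truth ac; apply: thR.
(* A substitution changes the valuation to [r] ↦ truth set of [s r]; this is again a valuation
   because truth sets are filters. *)
- move=> s phi psi _ IH V fV /=; rewrite !truth_subst.
  by apply: IH => r /=; apply: truth_mfilter.
- by move=> V fV x.
- by move=> V fV x /= ->; apply: mfilter_1.
- by move=> V fV x.
- by move=> V fV x [].
- by move=> V fV x [].
- by move=> V fV; apply: sub_filter_joinl.
- by move=> V fV; apply: sub_filter_joinr.
- by move=> V fV x.
- move=> V fV x _ /=.
  (* Every point has a successor: pull the loop at the top back along [x <= 1]. *)
  have [w [Rxw _]] := mf_back frR (lex1 x) ((mf_top frR _).2 erefl).
  by exists w.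
- by move=> V fV x [/= bp bq] y Rxy; split; [apply: bp | apply: bq].
- by move=> V fV x [/= [y [Rxy py]] bq]; exists y; do !split=> //; apply: bq.
- move=> phi psi chi _ IH1 _ IH2 V fV.
  exact: subset_trans (IH1 V fV) (IH2 V fV).
- by move=> phi psi chi _ IH1 _ IH2 V fV x fx; split; [apply: IH1|apply: IH2].
- move=> phi psi chi _ IH1 _ IH2 V fV; apply: filter_join_sub.
  + exact: truth_mfilter.
  + exact: IH1.
  + exact: IH2.
- by move=> phi psi _ IH V fV x /= bx y Rxy; apply: (IH V fV y); apply: bx.
- move=> phi psi _ IH V fV x /= [y [Rxy fy]]; exists y; split=> //.
  exact: (IH V fV y).
Qed.

End FrameSoundness.

(** * The dual frame of a modal lattice *)

Section DualFrame.
Variables (d : Order.disp_t) (A : tbLatticeType d) (box dia : A -> A).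
Hypothesis mlA : modal_lattice box dia.
Implicit Types (F G H : FilL A) (a b : A).
Local Notation R := (FilL_rel box dia).

Lemma box_mono a b : (a <= b)%O -> (box a <= box b)%O.
Proof.
by move=> /meet_idPl ab; rewrite -ab -(ml_box_meet mlA) leIr.
Qed.

Lemma dia_mono a b : (a <= b)%O -> (dia a <= dia b)%O.
Proof.
move=> /join_idPl ab; rewrite -[in leRHS]ab.
apply: le_trans (ml_dia_join mlA _ _).
exact: leUr.
Qed.

Lemma box_preimage_mfilter F : mfilter [set a | FilL_set F (box a)].
Proof.
have fF := FilL_filter F; split.
- by exists \top%O; rewrite /= (ml_box_top mlA); apply: mfilter_1.
- by move=> a b ab; apply: mfilter_up fF _; apply: box_mono.
- move=> a b Fa Fb; rewrite /= -(ml_box_meet mlA); exact: mfilter_meet.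
Qed.

(** The least R-successor of [F]: every successor contains it by the definition of [FilL_rel], and
    [FilL_rel_least] shows that it is one. *)
Definition box_preimage F : FilL A := MkFilL (box_preimage_mfilter F).

Lemma up_mfilter a : mfilter [set b | (a <= b)%O].
Proof.
split; first by exists a => /=.
- by move=> b c bc /= ab; apply: le_trans bc.
- by move=> b c /= ab ac; rewrite lexI ab.
Qed.

Definition up a : FilL A := MkFilL (up_mfilter a).

(** The existence lemma for successors. A member of the join of [G] with the □-preimage of [F] lies
    above some u ∧ v with u in [G] and □v in [F]; then ◇u ∧ □v is in [F], and so is ◇(u ∧ v). *)
Lemma FilL_rel_extend F G : (forall a, FilL_set G a -> FilL_set F (dia a)) ->
  exists H, R F H /\ (forall a, FilL_set G a -> FilL_set H a).
Proof.
move=> GF; have fF := FilL_filter F; have fG := FilL_filter G.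
have fB := box_preimage_mfilter F.
exists (MkFilL (filter_join_mfilter fG fB)); split; last first.
  exact: sub_filter_joinl.
move=> a; split=> [Fa|[u [v [/= Gu Fv uv]]]]; first exact: sub_filter_joinr.
apply: (mfilter_up fF (dia_mono uv)).
apply: (mfilter_up fF (ml_dia_box mlA _ _)).
by apply: mfilter_meet => //; apply: GF.
Qed.

Lemma FilL_rel_least F : R F (box_preimage F).
Proof.
(* Since ◇⊤ = ⊤, the least filter {⊤} extends to a successor [H]. Members of the □-preimage lie in
   [H], hence their ◇ lies in [F]. *)
have [|H [RFH _]] := @FilL_rel_extend F (up \top%O).
  move=> a /=; rewrite le1x => /eqP ->; rewrite (ml_dia_top mlA).
  exact: (mfilter_1 (FilL_filter F)).
by move=> a; split=> //= /(RFH a).1 /(RFH a).2.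
Qed.

Lemma FilL_boxE a F : FilL_set F (box a) <-> forall G, R F G -> FilL_set G a.
Proof.
split=> [Fa G /(_ a)[+ _]|]; first exact.
by move=> /(_ _ (FilL_rel_least F)).
Qed.

Lemma FilL_diaE a F : FilL_set F (dia a) <-> exists G, R F G /\ FilL_set G a.
Proof.
split=> [Fa|[G [/(_ a)[_]]]]; last by move=> GF /GF.
have [|H [RFH aH]] := @FilL_rel_extend F (up a).
  by move=> b /= ab; apply: (mfilter_up (FilL_filter F) (dia_mono ab)).
by exists H; split=> //; apply: aH => /=.
Qed.

Lemma FilL_leP F G :
  reflect (forall a, FilL_set F a -> FilL_set G a) (F <= G)%O.
Proof. exact: asboolP. Qed.

Lemma FilL_botE F : FilL_set F \bot%O <-> F = \top%O.
Proof.
split=> [F0|->] //; apply: FilL_inj; apply/seteqP; split=> // a _.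
exact: (mfilter_up (FilL_filter F) (le0x a)).
Qed.

(** The principal filters of [a] and [b] serve as witnesses: their intersection is the principal
    filter of the join. *)
Lemma FilL_joinE a b F :
  FilL_set F (a `|` b)%O <->
    exists G H, [/\ FilL_set G a, FilL_set H b & (G `&` H <= F)%O].
Proof.
have fF := FilL_filter F; split=> [Fab|[G [H [Ga Hb /FilL_leP]]]].
  exists (up a), (up b); split=> /=; [exact: lexx | exact: lexx | ].
  apply/FilL_leP => c [/= ac bc].
  by apply: (mfilter_up fF _ Fab); rewrite leUx ac.
apply; split.
  exact: (mfilter_up (FilL_filter G) (leUl a b)).
exact: (mfilter_up (FilL_filter H) (leUr b a)).
Qed.

Lemma FilL_rel_top F : R \top%O F <-> F = \top%O.
Proof.
split=> [RF|-> a]; last by split.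
by apply/FilL_botE; apply: (RF \bot%O).1.
Qed.

(** The conditions that ask for small successors, [mf_back] and [mf_meet_split], are met by the
    least ones; [mf_forth] asks for a large one and uses [FilL_rel_extend]. *)
Lemma FilL_modal_Lframe : modal_Lframe (R : FilL A -> FilL A -> Prop).
Proof.
split.
- move=> F G H /FilL_leP FG RGH; exists (box_preimage F).
  split; first exact: FilL_rel_least.
  by apply/FilL_leP => a /= /FG; apply: (RGH a).1.
- move=> F G H /FilL_leP FG RFH; have [|K [RGK HK]] := @FilL_rel_extend G H.
    by move=> a /(RFH a).2 /FG.
  by exists K; split=> //; apply/FilL_leP.
- move=> F G H RFGH; exists (box_preimage F), (box_preimage G).
  split; try exact: FilL_rel_least.
  by apply/FilL_leP => a /(RFGH a).1.
- move=> F G H K RFH RGK a; split=> -[Fa Ga]; split.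
  + exact: (RFH a).1.
  + exact: (RGK a).1.
  + exact: (RFH a).2.
  + exact: (RGK a).2.
- exact: FilL_rel_top.
Qed.

Lemma FilL_truth (P : Type) (s : P -> A) phi F :
  truth (R : FilL A -> FilL A -> Prop)
    (fun r => [set G : FilL A | FilL_set G (s r)]) phi F
    <-> FilL_set F (Defs.eval box dia s phi).
Proof.
elim: phi F => [r|||f1 IH1 f2 IH2|f1 IH1 f2 IH2|f IH|f IH] F //=.
- by split=> // _; apply: (mfilter_1 (FilL_filter F)).
- by rewrite FilL_botE.
- rewrite (mfilter_meetE _ _ (FilL_filter F)).
  by split=> -[/IH1 ? /IH2 ?].
- rewrite FilL_joinE; split=> -[G [H [/IH1 G1 /IH2 H2 GH]]];
  by exists G, H; split.
- rewrite FilL_boxE; split=> h G /h; by rewrite IH.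
- by rewrite FilL_diaE; split=> -[G [RFG /IH]] ?; exists G.
Qed.

Lemma FilL_Theta (P : Type) (p : P) (Gamma : set axname) :
  (forall c, pairs_of p Gamma c -> lattice_validates box dia c) ->
  satisfies_Theta Gamma (R : FilL A -> FilL A -> Prop).
Proof.
move=> val x Gx.
(* Only the letter [p] occurs in the axioms, so constant valuations give all their instances. *)
have {}val c a : ax_pairs p x c ->
  (Defs.eval box dia (fun _ : P => a) c.1 <=
   Defs.eval box dia (fun _ : P => a) c.2)%O.
  by move=> xc; apply: val; exists x.
have step c a F : ax_pairs p x c ->
    FilL_set F (Defs.eval box dia (fun _ : P => a) c.1) ->
    FilL_set F (Defs.eval box dia (fun _ : P => a) c.2).
  by move=> xc; apply: (mfilter_up (FilL_filter F)); apply: val.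
case: x {Gx val} step => step /=.
- move=> F a; split.
    by apply: (step (Box (Var p), Var p)); left.
  by apply: (step (Var p, Dia (Var p))); right.
- move=> F G H RFG RGH a; split.
    move/(step (Box (Var p), Box (Box (Var p))) a F (or_introl erefl)).
    by move/(RFG _).1/(RGH _).1.
  move/(RGH _).2/(RFG _).2.
  exact: (step (Dia (Dia (Var p)), Dia (Var p)) a F (or_intror erefl)).
- move=> F G RFG a; split.
    move/(RFG _).2.
    exact: (step (Dia (Box (Var p)), Var p) a F (or_intror erefl)).
  move/(step (Var p, Box (Dia (Var p))) a F (or_introl erefl)).
  by move/(RFG _).1.
- move=> F G H RFG RFH a; split.
    move/(RFG _).2.
    move/(step (Dia (Box (Var p)), Box (Var p)) a F (or_intror erefl)).
    by move/(RFH _).1.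
  move/(RFH _).2.
  move/(step (Dia (Var p), Box (Dia (Var p))) a F (or_introl erefl)).
  by move/(RFG _).1.
- move=> F G H RFG RFH.
  (* From □a in [F1] follow ◇□a in [F], then □◇a in [F] by the axiom, then ◇a in [F2]. *)
  have dot2 a F1 F2 : R F F1 -> R F F2 ->
      FilL_set F1 (box a) -> FilL_set F2 (dia a).
    move=> R1 R2 /(R1 _).2.
    move/(step (Dia (Box (Var p)), Box (Dia (Var p))) a F erefl).
    exact: (R2 _).1.
  have fG := box_preimage_mfilter G; have fH := box_preimage_mfilter H.
  (* A common successor must contain both □-preimages; their join is the least candidate. *)
  exists (MkFilL (filter_join_mfilter fG fH)).
  split=> a; split.
  + by move=> ba; apply: sub_filter_joinl.
  + move=> [u [v [/= Gu Hv uv]]].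
    apply: (mfilter_up (FilL_filter G) (dia_mono uv)).
    (* Here □u is in [G], and [dot2] turns □v in [H] into ◇v in [G], so the two conjuncts are
       swapped to fit ◇v ∧ □u ≤ ◇(v ∧ u). *)
    rewrite meetC; apply: (mfilter_up (FilL_filter G) (ml_dia_box mlA _ _)).
    apply: (mfilter_meet (FilL_filter G)) => //; exact: dot2 Hv.
  + by move=> ba; apply: sub_filter_joinr.
  + move=> [u [v [/= Gu Hv uv]]].
    apply: (mfilter_up (FilL_filter H) (dia_mono uv)).
    apply: (mfilter_up (FilL_filter H) (ml_dia_box mlA _ _)).
    apply: (mfilter_meet (FilL_filter H)) => //; exact: dot2 Gu.
Qed.

End DualFrame.

(** * The Lindenbaum algebra *)

Section DerivedRules.
Variables (P : Type) (p q : P) (G : set (cpair P)).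
Hypothesis p_neq_q : p <> q.
Implicit Types phi psi chi : formula P.
Local Notation L := (logic p q G).

(** Instantiates the two letters of the axioms at once. All letters other than [p] go to [psi],
    among them [q] because [p <> q]. *)
Definition subst2 phi psi (r : P) : formula P :=
  if pselect (r = p) then phi else psi.

Lemma subst2p phi psi : subst2 phi psi p = phi.
Proof. by rewrite /subst2; case: pselect. Qed.

Lemma subst2q phi psi : subst2 phi psi q = psi.
Proof. by rewrite /subst2; case: pselect => // E; case: p_neq_q. Qed.

Let inst phi psi := (subst2p phi psi, subst2q phi psi).

Lemma logic_refl phi : L (phi, phi).
Proof. by have := L_subst (subst2 phi phi) (L_refl p q G); rewrite /= inst. Qed.

Lemma logic_top phi : L (phi, Top).
Proof. by have := L_subst (subst2 phi phi) (L_top p q G); rewrite /= inst. Qed.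

Lemma logic_bot phi : L (Bot, phi).
Proof. by have := L_subst (subst2 phi phi) (L_bot p q G); rewrite /= inst. Qed.

Lemma logic_andl phi psi : L (And phi psi, phi).
Proof. by have := L_subst (subst2 phi psi) (L_andl p q G); rewrite /= !inst. Qed.

Lemma logic_andr phi psi : L (And phi psi, psi).
Proof. by have := L_subst (subst2 phi psi) (L_andr p q G); rewrite /= !inst. Qed.

Lemma logic_orl phi psi : L (phi, Or phi psi).
Proof. by have := L_subst (subst2 phi psi) (L_orl p q G); rewrite /= !inst. Qed.

Lemma logic_orr phi psi : L (psi, Or phi psi).
Proof. by have := L_subst (subst2 phi psi) (L_orr p q G); rewrite /= !inst. Qed.

Lemma logic_box_and phi psi :
  L (And (Box phi) (Box psi), Box (And phi psi)).
Proof.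
by have := L_subst (subst2 phi psi) (L_box_and p q G); rewrite /= !inst.
Qed.

Lemma logic_dia_and phi psi :
  L (And (Dia phi) (Box psi), Dia (And phi psi)).
Proof.
by have := L_subst (subst2 phi psi) (L_dia_and p q G); rewrite /= !inst.
Qed.

Lemma logic_and_mono phi psi phi' psi' :
  L (phi, phi') -> L (psi, psi') -> L (And phi psi, And phi' psi').
Proof.
move=> h h'; apply: L_and.
  exact: L_trans (logic_andl _ _) h.
exact: L_trans (logic_andr _ _) h'.
Qed.

Lemma logic_or_mono phi psi phi' psi' :
  L (phi, phi') -> L (psi, psi') -> L (Or phi psi, Or phi' psi').
Proof.
move=> h h'; apply: L_or.
  exact: L_trans h (logic_orl _ _).
exact: L_trans h' (logic_orr _ _).
Qed.

End DerivedRules.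

(* The class of [phi] modulo interderivability is represented by the set of
   formulas from which [phi] is derivable. The proof of [p <> q] is a parameter
   of the type because the lattice structure below depends on it. *)
Record lindenbaum (P : Type) (p q : P) (G : set (cpair P)) (p_neq_q : p <> q) :
    Type := Lindenbaum {
  lind_set : set (formula P);
  lind_principal : exists phi,
    lind_set = [set psi | logic p q G (psi, phi)]
}.

Fact lindenbaum_display : Order.disp_t. Proof. exact: (Order.Disp tt tt). Qed.

Section Lindenbaum.
Variables (P : Type) (p q : P) (G : set (cpair P)) (p_neq_q : p <> q).
Implicit Types phi psi chi : formula P.
Local Notation L := (logic p q G).
Local Notation A := (lindenbaum G p_neq_q).
Implicit Types x y z : A.

HB.instance Definition _ := gen_eqMixin A.
HB.instance Definition _ := gen_choiceMixin A.

Definition lind_class phi : A := Lindenbaum p_neq_q (ex_intro _ phi erefl).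

Definition lind_repr x : formula P := projT1 (cid (lind_principal x)).

Lemma lind_inj x y : lind_set x = lind_set y -> x = y.
Proof.
case: x y => [F hF] [H hH] /= E; move: hF; rewrite E => hF.
by rewrite (Prop_irrelevance hF hH).
Qed.

Lemma lind_reprK x : lind_class (lind_repr x) = x.
Proof. by apply: lind_inj; rewrite /= /lind_repr; case: cid. Qed.

(** Equal classes are equal sets of formulas; by reflexivity each of the two formulas belongs to its
    own set, hence to the other one. *)
Lemma lind_class_repr phi :
  L (phi, lind_repr (lind_class phi)) /\ L (lind_repr (lind_class phi), phi).
Proof.
have /(congr1 (@lind_set _ _ _ _ _)) /= E := lind_reprK (lind_class phi).
split.
  have : [set psi | L (psi, phi)] phi by apply: logic_refl.
  by rewrite -E.
have : [set psi | L (psi, lind_repr (lind_class phi))] (lind_repr (lind_class phi)).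
  exact: logic_refl.
by rewrite E.
Qed.

Definition lind_le x y : bool := `[< L (lind_repr x, lind_repr y) >].

Fact lind_le_refl : reflexive lind_le.
Proof. by move=> x; apply/asboolP; apply: logic_refl. Qed.

Fact lind_le_anti : antisymmetric lind_le.
Proof.
move=> x y /andP[/asboolP xy /asboolP yx].
rewrite -(lind_reprK x) -(lind_reprK y); apply: lind_inj.
by apply/seteqP; split=> phi /= h; apply: L_trans h _.
Qed.

Fact lind_le_trans : transitive lind_le.
Proof.
by move=> y x z /asboolP xy /asboolP yz; apply/asboolP; apply: L_trans yz.
Qed.

HB.instance Definition _ := Order.Le_isPOrder.Build lindenbaum_display A
  lind_le_refl lind_le_anti lind_le_trans.

Lemma lind_leP phi psi :
  reflect (L (phi, psi)) (lind_class phi <= lind_class psi)%O.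
Proof.
have [h1 h2] := lind_class_repr phi; have [h3 h4] := lind_class_repr psi.
rewrite [(_ <= _)%O]/(lind_le _ _).
apply: (iffP (asboolP _)) => h; first exact: L_trans h1 (L_trans h h4).
exact: L_trans h2 (L_trans h h3).
Qed.

Definition lind_meet x y : A := lind_class (And (lind_repr x) (lind_repr y)).
Definition lind_join x y : A := lind_class (Or (lind_repr x) (lind_repr y)).

Lemma lind_reprP x y : reflect (L (lind_repr x, lind_repr y)) (x <= y)%O.
Proof. exact: asboolP. Qed.

Lemma lind_le_classP x phi :
  reflect (L (lind_repr x, phi)) (x <= lind_class phi)%O.
Proof. by have := lind_leP (lind_repr x) phi; rewrite lind_reprK. Qed.

Lemma lind_class_leP phi x :
  reflect (L (phi, lind_repr x)) (lind_class phi <= x)%O.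
Proof. by have := lind_leP phi (lind_repr x); rewrite lind_reprK. Qed.

Fact lind_meetP x y z : (x <= lind_meet y z)%O = (x <= y)%O && (x <= z)%O.
Proof.
apply/lind_le_classP/andP => [h|[/lind_reprP h1 /lind_reprP h2]]; last exact: L_and.
split; apply/lind_reprP; apply: L_trans h _.
  exact: logic_andl.
exact: logic_andr.
Qed.

Fact lind_joinP x y z : (lind_join x y <= z)%O = (x <= z)%O && (y <= z)%O.
Proof.
apply/lind_class_leP/andP => [h|[/lind_reprP h1 /lind_reprP h2]]; last exact: L_or.
split; apply/lind_reprP; apply: L_trans h.
  exact: logic_orl.
exact: logic_orr.
Qed.

Fact lind_lex1 x : (x <= lind_class Top)%O.
Proof. exact/lind_le_classP/logic_top. Qed.

Fact lind_le0x x : (lind_class Bot <= x)%O.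
Proof. exact/lind_class_leP/logic_bot. Qed.

HB.instance Definition _ :=
  Order.POrder_isMeetSemilattice.Build lindenbaum_display A lind_meetP.
HB.instance Definition _ :=
  Order.POrder_isJoinSemilattice.Build lindenbaum_display A lind_joinP.
HB.instance Definition _ :=
  Order.hasTop.Build lindenbaum_display A lind_lex1.
HB.instance Definition _ :=
  Order.hasBottom.Build lindenbaum_display A lind_le0x.

Definition lind_box x : A := lind_class (Box (lind_repr x)).
Definition lind_dia x : A := lind_class (Dia (lind_repr x)).

Lemma lind_class_eq phi psi :
  L (phi, psi) -> L (psi, phi) -> lind_class phi = lind_class psi.
Proof. by move=> h1 h2; apply/le_anti/andP; split; apply/lind_leP. Qed.

Lemma lind_class_and phi psi :
  (lind_class phi `&` lind_class psi)%O = lind_class (And phi psi).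
Proof.
have [h1 h2] := lind_class_repr phi; have [h3 h4] := lind_class_repr psi.
by apply: lind_class_eq; apply: logic_and_mono.
Qed.

Lemma lind_class_or phi psi :
  (lind_class phi `|` lind_class psi)%O = lind_class (Or phi psi).
Proof.
have [h1 h2] := lind_class_repr phi; have [h3 h4] := lind_class_repr psi.
by apply: lind_class_eq; apply: logic_or_mono.
Qed.

Lemma lind_class_box phi : lind_box (lind_class phi) = lind_class (Box phi).
Proof.
have [h1 h2] := lind_class_repr phi.
by apply: lind_class_eq; apply: L_box.
Qed.

Lemma lind_class_dia phi : lind_dia (lind_class phi) = lind_class (Dia phi).
Proof.
have [h1 h2] := lind_class_repr phi.
by apply: lind_class_eq; apply: L_dia.
Qed.

(** A valuation in the algebra is a substitution by representatives, so closure of the logic under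
    substitution becomes validity of its hypotheses in the algebra. *)
Lemma lind_eval (s : P -> A) phi :
  Defs.eval lind_box lind_dia s phi = lind_class (subst (lind_repr \o s) phi).
Proof.
elim: phi => [r|||f1 IH1 f2 IH2|f1 IH1 f2 IH2|f IH|f IH] //=.
- by rewrite lind_reprK.
- by rewrite IH1 IH2 lind_class_and.
- by rewrite IH1 IH2 lind_class_or.
- by rewrite IH lind_class_box.
- by rewrite IH lind_class_dia.
Qed.

Lemma lind_eval_id phi :
  Defs.eval lind_box lind_dia (fun r => lind_class (Var r)) phi = lind_class phi.
Proof.
elim: phi => [r|||f1 IH1 f2 IH2|f1 IH1 f2 IH2|f IH|f IH] //=.
- by rewrite IH1 IH2 lind_class_and.
- by rewrite IH1 IH2 lind_class_or.
- by rewrite IH lind_class_box.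
- by rewrite IH lind_class_dia.
Qed.

Lemma lind_in_variety : in_variety G lind_box lind_dia.
Proof.
split; last first.
  move=> [phi psi] Gc s /=; rewrite !lind_eval; apply/lind_leP.
  exact/L_subst/L_hyp.
split.
- change (lind_box (lind_class Top) = lind_class Top); rewrite lind_class_box.
  by apply: lind_class_eq; [apply: logic_top | apply: L_box_top].
- change (lind_dia (lind_class Top) = lind_class Top); rewrite lind_class_dia.
  by apply: lind_class_eq; [apply: logic_top | apply: L_dia_top].
- move=> x y; rewrite -(lind_reprK x) -(lind_reprK y).
  rewrite (lind_class_and (lind_repr x)) !lind_class_box lind_class_and.
  apply: lind_class_eq; first exact: logic_box_and.
  by apply: L_and; apply: L_box; [apply: logic_andl | apply: logic_andr].
- move=> x y; rewrite -(lind_reprK x) -(lind_reprK y).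
  rewrite (lind_class_or (lind_repr x)) !lind_class_dia lind_class_or.
  apply/lind_leP; apply: L_or; apply: L_dia.
    exact: logic_orl.
  exact: logic_orr.
- move=> x y; rewrite -(lind_reprK x) -(lind_reprK y).
  rewrite (lind_class_and (lind_repr x)) !lind_class_dia lind_class_box lind_class_and.
  by apply/lind_leP; apply: logic_dia_and.
Qed.

End Lindenbaum.

(** Under the canonical valuation on the dual frame of the Lindenbaum algebra, [phi] holds at the
    principal filter of its class. Validity makes [psi] hold there, which places the class of [phi]
    below that of [psi]. *)
Lemma logic_frame_complete (P : Type) (p q : P) (p_neq_q : p <> q)
    (Gamma : set axname) (c : cpair P) :
  (forall (d : Order.disp_t) (X : tMeetSemilatticeType d) (R : X -> X -> Prop),
     modal_Lframe R -> satisfies_Theta Gamma R -> frame_validates R c) ->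
  logic p q (pairs_of p Gamma) c.
Proof.
case: c => phi psi valid.
have [mlA valA] := @lind_in_variety _ _ _ (pairs_of p Gamma) p_neq_q.
pose s r := lind_class (pairs_of p Gamma) p_neq_q (Var r).
pose F := up (lind_class (pairs_of p Gamma) p_neq_q phi).
have tr f := FilL_truth mlA s f F.
have fV r : mfilter [set H : FilL (lindenbaum (pairs_of p Gamma) p_neq_q) |
    FilL_set H (s r)].
  split.
  - by exists \top%O.
  - by move=> H K /FilL_leP HK /= /HK.
  - by move=> H K /= Hr Kr.
have h := valid _ _ _ (FilL_modal_Lframe mlA) (FilL_Theta mlA valA) _ fV F.
have /= := (tr psi).1 (h ((tr phi).2 _)).
by rewrite /= !lind_eval_id lexx => /(_ isT)/lind_leP.
Qed.

(** * The dual space of a modal lattice *)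

Section DualSpace.
Variables (d : Order.disp_t) (A : tbLatticeType d).
Implicit Types (F G H : FilL A) (a b : A).

Definition hat a : set (FilL A) := [set F | FilL_set F a].

Lemma FilL_subbase_open (U : set (FilL A)) : FilL_subbase U -> open U.
Proof.
move=> sU; exists [set U]; last by rewrite bigcup_set1.
by move=> _ ->; apply: (@finI_from1 _ _ _ id).
Qed.

Lemma open_hat a : open (hat a).
Proof. by apply: FilL_subbase_open; exists a; left. Qed.

Lemma open_hatC a : open (~` hat a).
Proof. by apply: FilL_subbase_open; exists a; right. Qed.

Lemma clopen_hat a : clopen (hat a).
Proof.
by split; [apply: open_hat | rewrite -[hat a]setCK; apply/open_closedC/open_hatC].
Qed.

Lemma mfilter_hat a : mfilter (hat a).
Proof.
split; first by exists \top%O.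
- by move=> F G /FilL_leP FG /FG.
- by move=> F G Fa Ga; split.
Qed.

(** Basic neighbourhoods in normal form: finitely many sets [hat a] merge into one by taking the
    meet, while the complements remain a finite list. *)
Lemma FilL_nbhsP F (U : set (FilL A)) : nbhs F U <->
  exists (a : A) (s : seq A), [/\ FilL_set F a, {in s, forall b, ~ FilL_set F b}
    & forall G, FilL_set G a -> {in s, forall b, ~ FilL_set G b} -> U G].
Proof.
split.
  rewrite nbhsE => -[B [[D' sD' <-] [W D'W WF]] BU].
  have {}WF : W F := WF.
  have [S sS ES] : finI_from (@FilL_subbase d A) id W := sD' _ D'W.
  (* The finite intersection is restated over the enumeration of [S] to allow induction on a
     list. *)
  suff [a [s [Fa Fs h]]] : exists (a : A) (s : seq A),
      [/\ FilL_set F a, {in s, forall b, ~ FilL_set F b}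
        & forall G, FilL_set G a -> {in s, forall b, ~ FilL_set G b} ->
            forall V, V \in finmap.enum_fset S -> V G].
    exists a, s; split=> // G Ga Gs; apply: BU; exists W => //.
    by suff : W G by []; rewrite -ES => V SV; apply: (h G).
  have {ES}SF V : V \in finmap.enum_fset S -> V F by move: WF; rewrite -ES; apply.
  have {}sS V : V \in finmap.enum_fset S -> FilL_subbase V by move/sS; rewrite inE.
  elim: (finmap.enum_fset S) SF sS => [|V l IH] lF sl.
    exists \top%O, [::]; split=> //; exact: (mfilter_1 (FilL_filter F)).
  have [||a [s [Fa Fs h]]] := IH.
  - by move=> W' W'l; apply: lF; rewrite inE W'l orbT.
  - by move=> W' W'l; apply: sl; rewrite inE W'l orbT.
  have VF : V F by apply: lF; rewrite mem_head.
  have [b Vb] : FilL_subbase V by apply: sl; rewrite mem_head.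
  case: Vb => E; rewrite E in VF.
  - exists (a `&` b)%O, s; split=> //.
      exact: (mfilter_meet (FilL_filter F)).
    move=> G /(mfilter_meetE _ _ (FilL_filter G))[Ga Gb] Gs W'.
    by rewrite inE => /orP[/eqP ->|]; [rewrite E | apply: h].
  - exists a, (b :: s); split=> //.
      by move=> c; rewrite inE => /orP[/eqP ->|/Fs].
    move=> G Ga Gs W'; rewrite inE => /orP[/eqP ->|].
      by rewrite E => /=; apply: Gs; rewrite mem_head.
    by apply: h => // c cs; apply: Gs; rewrite inE cs orbT.
move=> [a [s [Fa Fs h]]].
suff : nbhs F [set G | FilL_set G a /\ {in s, forall b, ~ FilL_set G b}].
  by apply: filterS => G [Ga Gs]; apply: h.
apply: filterI; first by apply: open_nbhs_nbhs; split=> //; apply: open_hat.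
elim: s Fs {h} => [|b s IH] Fs.
  by apply: filterS (filterT : nbhs F setT).
have Fs' : {in s, forall b, ~ FilL_set F b}.
  by move=> c cs; apply: Fs; rewrite inE cs orbT.
have Fb : nbhs F (~` hat b).
  apply: open_nbhs_nbhs; split; first exact: open_hatC.
  by apply: Fs; rewrite mem_head.
apply: filterS (filterI Fb (IH Fs')) => G [Gb Gs] c.
by rewrite inE => /orP[/eqP ->|/Gs].
Qed.

Lemma FilL_hausdorff : hausdorff_space (FilL A).
Proof.
rewrite open_hausdorff.
have sep F G a : FilL_set F a -> ~ FilL_set G a ->
    [/\ F \in hat a, G \in ~` hat a & (hat a `&` ~` hat a) == set0].
  by move=> Fa Ga; rewrite setICr !inE.
move=> F G /eqP FG; have [FsubG|/existsNP[a /not_implyP[Fa Ga]]] :=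
  pselect (forall a, FilL_set F a -> FilL_set G a).
  have [GsubF|/existsNP[a /not_implyP[Ga Fa]]] :=
      pselect (forall a, FilL_set G a -> FilL_set F a).
    by case: FG; apply: FilL_inj; apply/seteqP; split.
  exists (~` hat a, hat a) => /=.
    by have [] := sep _ _ _ Ga Fa.
  by rewrite setICl; split=> //; [apply: open_hatC | apply: open_hat].
exists (hat a, ~` hat a) => /=.
  by have [] := sep _ _ _ Fa Ga.
by rewrite setICr; split=> //; [apply: open_hat | apply: open_hatC].
Qed.

(* An ultrafilter [W] on the space converges to the filter of those [a] for
   which [hat a] is [W]-large. *)
Lemma FilL_compact : compact [set: FilL A].
Proof.
rewrite compact_ultra => W UW _.
have fK : mfilter [set a | W (hat a)].
  split.
  - exists \top%O; apply: filterS filterT => F _.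
    exact: (mfilter_1 (FilL_filter F)).
  - move=> a b ab; apply: filterS => F.
    exact: (mfilter_up (FilL_filter F) ab).
  - move=> a b Wa Wb; apply: filterS (filterI Wa Wb) => F [Fa Fb].
    exact: (mfilter_meet (FilL_filter F)).
exists (MkFilL fK); split=> // U /FilL_nbhsP[a [s [/= Wa Ws h]]].
suff Ws' : W [set G | {in s, forall b, ~ FilL_set G b}].
  by apply: filterS (filterI Wa Ws') => G [Ga Gs]; apply: h.
elim: s Ws {h} => [|b s IH] Ws.
  by apply: filterS (filterT : W setT).
have Ws' : {in s, forall b, ~ W (hat b)}.
  by move=> c cs; apply: Ws; rewrite inE cs orbT.
have Wb : W (~` hat b).
  (* An ultrafilter contains [hat b] or its complement, and the former is excluded for [b] in
     [s]. *)
  have [Wb|//] := in_ultra_setVsetC (hat b) UW.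
  by case: (Ws b (mem_head _ _)).
apply: filterS (filterI Wb (IH Ws')) => G [Gb Gs] c.
by rewrite inE => /orP[/eqP ->|/Gs].
Qed.

(* A closed filter of filters contains its intersection [K]; if it is moreover
   open, some basic neighbourhood of [K] forces [K] to be principal. *)
Lemma clopen_filter_hat (U : set (FilL A)) :
  clopen U -> mfilter U -> exists a, U = hat a.
Proof.
move=> [oU cU] fU.
have fK : mfilter [set a | forall F, U F -> FilL_set F a].
  split.
  - exists \top%O => F _; exact: (mfilter_1 (FilL_filter F)).
  - move=> a b ab Ka F UF; apply: (mfilter_up (FilL_filter F) ab); exact: Ka.
  - move=> a b Ka Kb F UF.
    by apply: (mfilter_meet (FilL_filter F)); [apply: Ka | apply: Kb].
pose K := MkFilL fK.
have UK : U K.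
  apply: cU => V /FilL_nbhsP[a [s [Ka Ks h]]].
  (* [K] is in the closure of [U]: each [b] in [s] is omitted by some member of [U], and the
     intersection of these members stays in [U] and omits all of [s]. *)
  suff [F [UF Fs]] : exists F, U F /\ {in s, forall b, ~ FilL_set F b}.
    by exists F; split=> //; apply: h => //; apply: Ka.
  elim: s Ks {h} => [|b s IH] Ks.
    by exists \top%O; split=> //; apply: mfilter_1.
  have [|F [UF Fs]] := IH.
    by move=> c cs; apply: Ks; rewrite inE cs orbT.
  have /existsNP[G /not_implyP[UG Gb]] : ~ FilL_set K b.
    by apply: Ks; rewrite mem_head.
  exists (F `&` G)%O; split; first exact: mfilter_meet.
  move=> c; rewrite inE => /orP[/eqP ->|/Fs nFc]; by case.
have /FilL_nbhsP[a [s [Ka Ks h]]] : nbhs K U by apply: open_nbhs_nbhs.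
(* If [up a] contained some [b] of [s], then [b] would lie above [a], hence in [K]. *)
have Ua : U (up a).
  apply: h => [|b bs /= ab]; first exact: lexx.
  by apply: (Ks b bs); apply: (mfilter_up (FilL_filter K) ab).
exists a; apply/seteqP; split=> F; first by move/Ka.
move=> Fa; apply: (mfilter_up fU _ Ua); apply/FilL_leP => b /= ab.
exact: (mfilter_up (FilL_filter F) ab).
Qed.

Lemma FilL_clopen_filterP (U : set (FilL_space A)) :
  clopen_filter U <-> exists a, U = hat a.
Proof.
split=> [[cU fU]|[a ->]]; first exact: clopen_filter_hat.
by split; [apply: clopen_hat | apply: mfilter_hat].
Qed.

Lemma FilL_Lspace : Lspace (FilL_space A).
Proof.
split.
- exact: FilL_compact.
- move=> F G nFG.
  have /existsNP[a /not_implyP[Fa Ga]] :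
      ~ (forall a, FilL_set F a -> FilL_set G a).
    by move=> FG; apply: nFG; apply/FilL_leP.
  by exists (hat a); split=> //; apply/FilL_clopen_filterP; exists a.
- suff -> : [set (\top%O : FilL_space A)] = hat \bot%O by apply: clopen_hat.
  by apply/seteqP; split=> F /= /FilL_botE.
- move=> U V /FilL_clopen_filterP[a ->] /FilL_clopen_filterP[b ->].
  rewrite smallest_mfilterU; try exact: mfilter_hat.
  suff -> : filter_join (hat a) (hat b) = hat (a `|` b)%O by apply: clopen_hat.
  by apply/seteqP; split=> F /FilL_joinE.
Qed.

(** The truth clauses for □ and ◇ say that [boxR] and [diaR] send [hat a] to [hat (box a)] and
    [hat (dia a)]; tightness is then the definition of [FilL_rel] read through [hat]. *)
Lemma FilL_modal_Lspace (box dia : A -> A) :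
  modal_lattice box dia -> modal_Lspace (FilL_rel box dia).
Proof.
move=> mlA.
have boxE a : boxR (FilL_rel box dia) (hat a) = hat (box a).
  by apply/seteqP; split=> F /(FilL_boxE mlA).
have diaE a : diaR (FilL_rel box dia) (hat a) = hat (dia a).
  by apply/seteqP; split=> F /(FilL_diaE mlA).
split.
- exact: FilL_Lspace.
- apply/seteqP; split=> // F _; exists (box_preimage mlA F).
  by split=> //; apply: FilL_rel_least.
- exact: FilL_rel_top.
- move=> U /FilL_clopen_filterP[a ->]; rewrite boxE.
  by apply/FilL_clopen_filterP; exists (box a).
- move=> U /FilL_clopen_filterP[a ->]; rewrite diaE.
  by apply/FilL_clopen_filterP; exists (dia a).
- move=> F G; split=> [RFG U /FilL_clopen_filterP[a ->]|h a].
    by rewrite boxE diaE; apply: RFG.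
  have := h (hat a); rewrite boxE diaE; apply.
  by apply/FilL_clopen_filterP; exists a.
Qed.

End DualSpace.

(** * Transport of structure along isomorphisms of modal L-spaces *)

Section IsoTransfer.
Variables (d d' : Order.disp_t) (X : topMeetType d) (Y : topMeetType d').
Variables (R : X -> X -> Prop) (S : Y -> Y -> Prop) (f : X -> Y) (g : Y -> X).
Hypotheses (fK : cancel f g) (gK : cancel g f).
Hypotheses (fc : continuous (f : tm_space X -> tm_space Y)).
Hypotheses (f1 : f \top%O = \top%O).
Hypotheses (fI : forall x y, f (x `&` y)%O = (f x `&` f y)%O).
Hypotheses (fR : forall x y, R x y <-> S (f x) (f y)).

Lemma iso_le x y : (f x <= f y)%O = (x <= y)%O.
Proof. by rewrite !leEmeet -fI (can_eq fK). Qed.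

Lemma iso_inv1 : g \top%O = \top%O.
Proof. by rewrite -f1 fK. Qed.

Lemma iso_invI u v : g (u `&` v)%O = (g u `&` g v)%O.
Proof. by apply: (can_inj fK); rewrite fI !gK. Qed.

Lemma iso_preimage_mfilter (U : set Y) : mfilter U -> mfilter (f @^-1` U).
Proof.
move=> fU; split.
- by exists \top%O; rewrite /preimage /= f1; apply: mfilter_1.
- by move=> x y; rewrite -iso_le => xy; apply: (mfilter_up fU xy).
- by move=> x y Ux Uy; rewrite /preimage /= fI; apply: mfilter_meet.
Qed.

Lemma iso_preimage_clopen_filter (U : set Y) :
  clopen_filter U -> clopen_filter (f @^-1` U : set X).
Proof.
move=> [cU fU]; split; last exact: iso_preimage_mfilter.
exact: (@preimage_clopen (tm_space X) (tm_space Y) f U cU fc).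
Qed.

Lemma iso_preimage_boxR (U : set Y) :
  f @^-1` (boxR S U) = boxR R (f @^-1` U).
Proof.
apply/seteqP; split=> x /= h y; first by rewrite fR => /h.
by move=> Sxy; rewrite -(gK y); apply: h; rewrite fR gK.
Qed.

Lemma iso_preimage_diaR (U : set Y) :
  f @^-1` (diaR S U) = diaR R (f @^-1` U).
Proof.
apply/seteqP; split=> x /= [y [Sxy Uy]].
  by exists (g y); rewrite fR /= gK.
by exists (f y); rewrite -fR.
Qed.

End IsoTransfer.

(** Preimages along [f] and [g] give inverse correspondences between the clopen filters of the two
    spaces, and along [f] they commute with [boxR] and [diaR]. *)
Lemma modal_Lspace_iso_transfer (d d' : Order.disp_t) (X : topMeetType d)
    (Y : topMeetType d') (R : X -> X -> Prop) (S : Y -> Y -> Prop) :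
  modal_Lspace_iso R S -> modal_Lspace S -> modal_Lspace R.
Proof.
move=> [f [g [[fK gK] [fc gc] f1 fI fR]]] mS.
have g1 := iso_inv1 fK f1; have gI := iso_invI fK gK fI.
have [LY dtop top boxc diac tight] := mS.
have gR u v : S u v <-> R (g u) (g v) by rewrite fR !gK.
have prefg (U : set X) : f @^-1` (g @^-1` U) = U.
  by apply/seteqP; split=> x; rewrite /preimage /= fK.
have cfg (U : set X) : clopen_filter U -> clopen_filter (g @^-1` U : set Y).
  exact: iso_preimage_clopen_filter.
have cff (U : set Y) : clopen_filter U -> clopen_filter (f @^-1` U : set X).
  exact: iso_preimage_clopen_filter.
have boxf := iso_preimage_boxR gK fR; have diaf := iso_preimage_diaR gK fR.
split.
- split.
  + have -> : [set: tm_space X] = g @` [set: tm_space Y].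
      by apply/seteqP; split=> // x _; exists (f x) => //; rewrite fK.
    apply: (@continuous_compact (tm_space Y) (tm_space X)).
      exact: continuous_subspaceT.
    exact: ls_compact.
  + move=> x y; rewrite -(iso_le fK fI) => /(ls_separated LY)[U [cU Ux Uy]].
    by exists (f @^-1` U); split=> //; apply: cff.
  + have -> : [set (\top%O : X)] = f @^-1` [set \top%O].
      apply/seteqP; split=> x /=; first by move=> ->.
      by rewrite -f1 => /(can_inj fK).
    exact: (@preimage_clopen (tm_space X) (tm_space Y) f _ (ls_top LY) fc).
  + move=> U V cU cV.
    have [_ fU] := cU; have [_ fV] := cV.
    have [_ fU'] := cfg _ cU; have [_ fV'] := cfg _ cV.
    have := ls_join LY (cfg _ cU) (cfg _ cV).
    rewrite !smallest_mfilterU //.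
    move=> /(@preimage_clopen (tm_space X) (tm_space Y) f _)/(_ fc).
    (* The join of the [g]-preimages, pulled back along [f], is the join of [U] and [V]. *)
    congr clopen; apply/seteqP; split=> x.
      move=> [u [v [/= Uu Vv uv]]]; exists (g u), (g v); split=> //.
      by rewrite -gI -(iso_le fK fI) gK.
    move=> [u [v [Uu Vv uv]]]; exists (f u), (f v).
    by split; rewrite /= ?fK // -fI (iso_le fK fI).
- apply/seteqP; split=> // x _.
  have : diaR S [set: Y] (f x) by rewrite dtop.
  by move=> [y [Sxy _]]; exists (g y); rewrite fR gK.
- move=> x; rewrite fR f1 top; split=> [h|->//].
  by apply: (can_inj fK); rewrite h f1.
- by move=> U cU; rewrite -(prefg U) -boxf; apply/cff/boxc/cfg.
- by move=> U cU; rewrite -(prefg U) -diaf; apply/cff/diac/cfg.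
- move=> x y; rewrite fR tight; split=> h U cU.
    have := h _ (cfg _ cU); rewrite -[in boxR R U](prefg U) -boxf.
    by rewrite -[in diaR R U](prefg U) -diaf /preimage /= fK.
  by have := h _ (cff _ cU); rewrite -boxf -diaf.
Qed.

Lemma satisfies_Theta_iso (Gamma : set axname) (X Y : Type)
    (R : X -> X -> Prop) (S : Y -> Y -> Prop) (f : X -> Y) (g : Y -> X) :
  cancel g f -> (forall x y, R x y <-> S (f x) (f y)) ->
  satisfies_Theta Gamma S -> satisfies_Theta Gamma R.
Proof.
move=> gK fR thS a /thS; case: a => /= hS.
- by move=> x; apply/fR.
- by move=> x y z /fR Sxy /fR Syz; apply/fR; apply: hS Syz.
- by move=> x y /fR Sxy; apply/fR; apply: hS.
- by move=> x y z /fR Sxy /fR Sxz; apply/fR; apply: hS Sxz.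
- move=> x y z /fR Sxy /fR Sxz; have [t [St St']] := hS _ _ _ Sxy Sxz.
  by exists (g t); rewrite !fR gK.
Qed.

(** * The lattice of clopen filters of an L-space *)

(* The proof of [Lspace X] is a parameter of the type because joins of clopen
   filters need it to be clopen. *)
Record clopfil (d : Order.disp_t) (X : topMeetType d) (LX : Lspace X) : Type :=
  Clopfil { clopfil_set : set X; clopfilP : clopen_filter clopfil_set }.

Fact clopfil_display : Order.disp_t. Proof. exact: (Order.Disp tt tt). Qed.

Section ClopenFilterLattice.
Variables (d : Order.disp_t) (X : topMeetType d) (LX : Lspace X).
Local Notation A := (clopfil LX).
Implicit Types U V W : A.

HB.instance Definition _ := gen_eqMixin A.
HB.instance Definition _ := gen_choiceMixin A.

Lemma clopfil_inj U V : clopfil_set U = clopfil_set V -> U = V.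
Proof.
case: U V => [U hU] [V hV] /= E; move: hU; rewrite E => hU.
by rewrite (Prop_irrelevance hU hV).
Qed.

Lemma clopfil_mfilter U : mfilter (clopfil_set U).
Proof. by case: (clopfilP U). Qed.

Definition clopfil_le U V : bool := `[< clopfil_set U `<=` clopfil_set V >].

Fact clopfil_le_refl : reflexive clopfil_le.
Proof. by move=> U; apply/asboolP. Qed.

Fact clopfil_le_anti : antisymmetric clopfil_le.
Proof.
move=> U V /andP[/asboolP UV /asboolP VU]; apply: clopfil_inj.
by apply/seteqP; split.
Qed.

Fact clopfil_le_trans : transitive clopfil_le.
Proof.
move=> V U W /asboolP UV /asboolP VW; apply/asboolP.
exact: subset_trans VW.
Qed.

HB.instance Definition _ := Order.Le_isPOrder.Build clopfil_display A
  clopfil_le_refl clopfil_le_anti clopfil_le_trans.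

Lemma clopfil_leP U V :
  reflect (clopfil_set U `<=` clopfil_set V) (U <= V)%O.
Proof. exact: asboolP. Qed.

Fact clopfil_meet_subproof U V :
  clopen_filter (clopfil_set U `&` clopfil_set V).
Proof.
case: (clopfilP U) (clopfilP V) => cU fU [cV fV].
by split; [apply: (@clopenI (tm_space X)) | apply: mfilter_setI].
Qed.

Definition clopfil_meet U V : A := Clopfil LX (clopfil_meet_subproof U V).

Fact clopfil_meetP U V W :
  (U <= clopfil_meet V W)%O = (U <= V)%O && (U <= W)%O.
Proof.
apply/clopfil_leP/andP => [h|[/clopfil_leP h1 /clopfil_leP h2] x Ux].
  by split; apply/clopfil_leP => x /h[].
by split; [apply: h1 | apply: h2].
Qed.

Fact clopfil_join_subproof U V :
  clopen_filter (filter_join (clopfil_set U) (clopfil_set V)).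
Proof.
have [fU fV] := (clopfil_mfilter U, clopfil_mfilter V).
split; last exact: filter_join_mfilter.
by rewrite -smallest_mfilterU //; apply: ls_join => //; apply: clopfilP.
Qed.

Definition clopfil_join U V : A := Clopfil LX (clopfil_join_subproof U V).

Fact clopfil_joinP U V W :
  (clopfil_join U V <= W)%O = (U <= W)%O && (V <= W)%O.
Proof.
have [fU fV] := (clopfil_mfilter U, clopfil_mfilter V).
apply/clopfil_leP/andP => [h|[/clopfil_leP h1 /clopfil_leP h2]].
  split; apply/clopfil_leP => x Ux; apply: h.
    exact: sub_filter_joinl.
  exact: sub_filter_joinr.
by apply: filter_join_sub => //; apply: clopfil_mfilter.
Qed.

Fact clopfil_top_subproof : clopen_filter [set: X].
Proof. by split; [apply: (@clopenT (tm_space X)) | apply: mfilter_setT]. Qed.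

Definition clopfil_top : A := Clopfil LX clopfil_top_subproof.

Fact clopfil_lex1 U : (U <= clopfil_top)%O.
Proof. exact/clopfil_leP. Qed.

Fact clopfil_bot_subproof : clopen_filter [set (\top%O : X)].
Proof. by split; [apply: ls_top | apply: mfilter_set1]. Qed.

Definition clopfil_bot : A := Clopfil LX clopfil_bot_subproof.

Fact clopfil_le0x U : (clopfil_bot <= U)%O.
Proof.
by apply/clopfil_leP => x /= ->; apply: mfilter_1; apply: clopfil_mfilter.
Qed.

HB.instance Definition _ :=
  Order.POrder_isMeetSemilattice.Build clopfil_display A clopfil_meetP.
HB.instance Definition _ :=
  Order.POrder_isJoinSemilattice.Build clopfil_display A clopfil_joinP.
HB.instance Definition _ :=
  Order.hasTop.Build clopfil_display A clopfil_lex1.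
HB.instance Definition _ :=
  Order.hasBottom.Build clopfil_display A clopfil_le0x.

Fact point_filter_subproof (x : X) : mfilter [set U : A | clopfil_set U x].
Proof.
split; first by exists \top%O.
- by move=> U V /clopfil_leP UV /= /UV.
- by move=> U V /= Ux Vx; split.
Qed.

Definition point_filter (x : X) : FilL A := MkFilL (point_filter_subproof x).

(** Injectivity is the separation axiom of L-spaces. *)
Lemma point_filter_inj : injective point_filter.
Proof.
move=> x y xy; apply/le_anti/andP.
have sub u v : point_filter u = point_filter v -> (u <= v)%O.
  move=> uv; apply: contrapT => /(ls_separated LX)[U [cU Uu nUv]]; apply: nUv.
  have : FilL_set (point_filter u) (Clopfil LX cU) by [].
  by rewrite uv.
by split; apply: sub.
Qed.

(* Some [U] in [F] is below all members of [s] in [F]; for each [V] in [s]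
   outside [F] pick a point of [U] not in [V], and take the meet of these. *)
Lemma FilL_finite_witness (F : FilL A) (s : seq A) :
  exists x, {in s, forall U, clopfil_set U x <-> FilL_set F U}.
Proof.
have fF := FilL_filter F.
have [U FU sU] : exists2 U, FilL_set F U & {in s, forall V,
    FilL_set F V -> clopfil_set U `<=` clopfil_set V}.
  elim: s => [|V s [U FU sU]].
    by exists \top%O => //; apply: mfilter_1.
  have [FV|nFV] := pselect (FilL_set F V); last first.
    by exists U => // W; rewrite inE => /orP[/eqP ->|/sU].
  exists (U `&` V)%O; first exact: mfilter_meet.
  move=> W; rewrite inE => /orP[/eqP -> _ x []|Ws FW x [Ux _]] //.
  exact: sU Ux.
suff [x Ux sx] : exists2 x, clopfil_set U x & {in s, forall V,
    clopfil_set V x -> FilL_set F V}.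
  by exists x => V Vs; split=> [|FV]; [apply: sx | apply: sU Ux].
elim: s {sU} => [|V s [x Ux sx]].
  by exists \top%O => //; apply: mfilter_1; apply: clopfil_mfilter.
have [FV|nFV] := pselect (FilL_set F V).
  by exists x => // W; rewrite inE => /orP[/eqP ->|/sx].
have /existsNP[y /not_implyP[Uy nVy]] : ~ clopfil_set U `<=` clopfil_set V.
  by move=> UV; apply/nFV/(mfilter_up fF _ FU)/clopfil_leP.
exists (x `&` y)%O; first by apply: mfilter_meet => //; apply: clopfil_mfilter.
move=> W; rewrite inE => /orP[/eqP ->|Ws].
  by move=> /(mfilter_meetE _ _ (clopfil_mfilter V))[].
by move=> /(mfilter_meetE _ _ (clopfil_mfilter W))[Wx _]; apply: sx.
Qed.

(** [f U] collects the points that decide [U] as [F] does; it is [U] or its complement, hence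
    closed. Finitely many of these sets meet by [FilL_finite_witness], so compactness gives a point
    in all of them. *)
Lemma point_filter_surj (F : FilL A) : exists x, point_filter x = F.
Proof.
pose f U : set (tm_space X) :=
  [set x | clopfil_set U x <-> FilL_set F U].
have cf U : closed (f U).
  have [[oU cU] _] := clopfilP U.
  have [FU|nFU] := pselect (FilL_set F U).
    have -> // : f U = clopfil_set U.
    by apply/seteqP; split=> x /=; [move=> [_]; apply | move=> Ux; split].
  have -> : f U = ~` clopfil_set U by apply/seteqP; split=> x; rewrite /f /=; tauto.
  exact: open_closedC.
have fin : finI [set: A] f.
  move=> s _; have [x sx] := FilL_finite_witness F (finmap.enum_fset s).
  by exists x => U sU; apply: sx.
have [//|x [_ cx]] := ls_compact LX (finI_filter fin).
  exact: (@filterT _ _ (finI_filter fin)).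
exists x; apply: FilL_inj; apply/seteqP.
have fx U : f U x.
  apply: cf; move: cx; rewrite clusterE; apply.
  by exists (f U) => //; apply: finI_from1.
by split=> U /=; apply fx.
Qed.

Definition filter_point (F : FilL A) : X := projT1 (cid (point_filter_surj F)).

Lemma filter_pointK : cancel filter_point point_filter.
Proof. by move=> F; rewrite /filter_point; case: cid. Qed.

Lemma point_filterK : cancel point_filter filter_point.
Proof. by move=> x; apply: point_filter_inj; apply: filter_pointK. Qed.

Lemma point_filter_continuous :
  continuous (point_filter : tm_space X -> tm_space (FilL_space A)).
Proof.
move=> x W /FilL_nbhsP[U [s [Ux sx h]]].
suff : @nbhs _ (tm_space X) x [set y | clopfil_set U y /\
    {in s, forall V, ~ clopfil_set V y}].
  apply: filterS => y [Uy sy]; exact: h.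
apply: filterI.
  by apply: open_nbhs_nbhs; split=> //; case: (clopfilP U) => -[].
elim: s sx {h} => [|V s IH] sx.
  by apply: filterS (filterT : @nbhs _ (tm_space X) x setT).
have sx' : {in s, forall V, ~ FilL_set (point_filter x) V}.
  by move=> W' W's; apply: sx; rewrite inE W's orbT.
have Vx : @nbhs _ (tm_space X) x (~` clopfil_set V).
  apply: open_nbhs_nbhs; split; last exact: (sx V (mem_head _ _)).
  by apply: closed_openC; case: (clopfilP V) => -[].
apply: filterS (filterI Vx (IH sx')) => y [Vy sy] W'.
by rewrite inE => /orP[/eqP ->|/sy].
Qed.

(* A continuous bijection from a compact space to a Hausdorff space. *)
Lemma filter_point_continuous :
  continuous (filter_point : tm_space (FilL_space A) -> tm_space X).
Proof.
apply/continuous_closedP => C cC.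
have -> : filter_point @^-1` C = (point_filter : tm_space X -> FilL A) @` C.
  apply/seteqP; split=> [F CF|_ [x Cx <-]].
    by exists (filter_point F) => //; apply: filter_pointK.
  by rewrite /preimage /= point_filterK.
apply: compact_closed; first exact: FilL_hausdorff.
apply: continuous_compact.
  exact: continuous_subspaceT point_filter_continuous.
exact: subclosed_compact cC (ls_compact LX) _.
Qed.

Variables (R : X -> X -> Prop) (mR : modal_Lspace R).

Definition clopfil_box U : A := Clopfil LX (ms_box mR (clopfilP U)).
Definition clopfil_dia U : A := Clopfil LX (ms_dia mR (clopfilP U)).

Lemma clopfil_modal_lattice : modal_lattice clopfil_box clopfil_dia.
Proof.
split.
- by apply: clopfil_inj; apply/seteqP; split.
(* ◇⊤ = ⊤ is the requirement that every point have a successor. *)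
- exact/clopfil_inj/(ms_dia_top mR).
- move=> U V; apply: clopfil_inj; apply/seteqP; split=> x /=.
    by move=> [bU bV] y Rxy; split; [apply: bU | apply: bV].
  by move=> h; split=> y /h[].
- move=> U V; rewrite leUx; apply/andP.
  have mono W W' : (W <= W')%O -> (clopfil_dia W <= clopfil_dia W')%O.
    move=> /clopfil_leP WW'; apply/clopfil_leP => x /= [y [Rxy /WW' Wy]].
    by exists y.
  by split; apply: mono; [apply: leUl | apply: leUr].
- move=> U V; apply/clopfil_leP => x [/= [y [Rxy Uy]] bV].
  by exists y; split=> //; split=> //; apply: bV.
Qed.

Lemma clopfil_in_variety (P : Type) (p : P) (Gamma : set axname) :
  satisfies_Theta Gamma R ->
  in_variety (pairs_of p Gamma) clopfil_box clopfil_dia.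
Proof.
move=> thR; split; first exact: clopfil_modal_lattice.
move=> c [a Ga ac] s; apply/clopfil_leP.
have := ax_pairs_truth (V := fun r => clopfil_set (s r)) (thR a Ga) ac.
(* Once the axiom is known, evaluation in the lattice and the truth set unfold to the same set. *)
by case: a {Ga} ac => /=; [case| case | case | case | ] => ->.
Qed.

(** This is tightness, with the quantifier over clopen filters read as one over elements of the
    lattice. *)
Lemma point_filter_rel x y :
  R x y <-> FilL_rel clopfil_box clopfil_dia (point_filter x) (point_filter y).
Proof.
rewrite (ms_tight mR); split=> [h U|h U cU]; first exact: h (clopfilP U).
exact: (h (Clopfil LX cU)).
Qed.

Lemma point_filter_iso :
  modal_Lspace_iso R (FilL_rel clopfil_box clopfil_dia).
Proof.
exists point_filter, filter_point; split.
- by split; [apply: point_filterK | apply: filter_pointK].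
- split; first exact: point_filter_continuous.
  exact: filter_point_continuous.
- apply: FilL_inj; apply/seteqP; split=> // U _.
  exact: (mfilter_1 (clopfil_mfilter U)).
- move=> x y; apply: FilL_inj; apply/seteqP.
  by split=> U /(mfilter_meetE _ _ (clopfil_mfilter U)).
- exact: point_filter_rel.
Qed.

End ClopenFilterLattice.

Theorem theorem4p17 (P : Type) (p q : P) (p_neq_q : p <> q)
    (Gamma : set axname) :
  (forall (d : Order.disp_t) (X : topMeetType d) (R : X -> X -> Prop),
     (modal_Lspace R /\ satisfies_Theta Gamma R) <->
     (exists (d' : Order.disp_t) (A : tbLatticeType d') (box dia : A -> A),
        in_variety (pairs_of p Gamma) box dia /\
        modal_Lspace_iso R (FilL_rel box dia)))
  /\
  (forall c : cpair P,
     (forall (d : Order.disp_t) (X : tMeetSemilatticeType d)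
             (R : X -> X -> Prop),
        modal_Lframe R -> satisfies_Theta Gamma R -> frame_validates R c) <->
     logic p q (pairs_of p Gamma) c).
Proof.
split=> [d X R|c]; last first.
  split; first exact: logic_frame_complete.
  by move=> Lc d X R frR thR; apply: logic_frame_sound Lc.
split=> [[mR thR]|[d' [A [box [dia [[mlA valA] iso]]]]]].
  exists clopfil_display, (clopfil (ms_Lspace mR)).
  exists (clopfil_box mR), (clopfil_dia mR).
  by split; [apply: clopfil_in_variety | apply: point_filter_iso].
split; first exact: modal_Lspace_iso_transfer iso (FilL_modal_Lspace mlA).
have [f [g [[_ gK] _ _ _ fR]]] := iso.
exact: satisfies_Theta_iso gK fR (FilL_Theta mlA valA).
Qed.
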